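(* Let $X$ be a random variable on a finite set $\mathcal{X}$ with distribution $p_X$, let $\mathcal{H}$ be a finite-dimensional Hilbert space, and let $\mathcal{E}=\{(\rho_x,p_X(x))\}_{x\in\mathcal{X}}$ be a quantum ensemble of density matrices on $\mathcal{H}$. Let $U$ be a unitary operator on $\mathcal{H}$ and define $U\mathcal{E}U^\dagger=\{(U\rho_xU^\dagger,p_X(x))\}_{x\in\mathcal{X}}$. Then $$G(X|\mathcal{E})=G(X|U\mathcal{E}U^\dagger).$$
   Context: Let $n=|\mathcal{X}|$. A POVM on $\mathcal{H}$ is a family $E=\{E_y\}_{y\in\mathcal{Y}}$, indexed by a finite set $\mathcal{Y}$ (which may depend on $E$), of positive semidefinite operators on $\mathcal{H}$ with $\sum_yE_y=I$. Given an ensemble $\mathcal{E}=\{(\rho_x,p_X(x))\}_{x\in\mathcal{X}}$ and a POVM $E$, $Y_E$ is the $\mathcal{Y}$-valued random variable with joint law $p_{X,Y_E}(x,y)=p_X(x)\operatorname{Tr}[E_y\rho_x]$. A guessing strategy $\sigma$ assigns to each $y\in\mathcal{Y}$ a bijection $\sigma_y:\{1,\dots,n\}\to\mathcal{X}$ ($\sigma_y(i)$ is the $i$-th guess when $y$ is observed), and $$\mathcal{G}_\sigma(X|Y_E)=\sum_{y\in\mathcal{Y}}\sum_{i=1}^n i\cdot p_{X,Y_E}(\sigma_y(i),y).$$ The quantum guesswork of $X$ given $\mathcal{E}$ is $G(X|\mathcal{E})=\inf_{\sigma,E}\mathcal{G}_\sigma(X|Y_E)$, over all POVMs $E$ on $\mathcal{H}$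 and all strategies $\sigma$. *)

(* Defs.v *)
From HB Require Import structures.
From mathcomp Require Import all_boot all_order all_algebra.
From mathcomp Require Import spectral sesquilinear.
From mathcomp Require Import complex.
From mathcomp Require Import classical_sets reals.

Set Implicit Arguments.
Unset Strict Implicit.
Unset Printing Implicit Defensive.

Import Order.TTheory GRing.Theory Num.Theory.

Local Open Scope ring_scope.
Local Open Scope sesquilinear_scope.

(* The Hilbert space is C^d, with C = R[i]: operators are d x d matrices acting
   on column vectors, and the adjoint of A is A ^t*. *)

Definition psdmx (R : realType) (d : nat) (A : 'M[R[i]]_d) : Prop :=
  A \is hermsymmx /\ forall v : 'cV[R[i]]_d, 0 <= (v ^t* *m A *m v) 0 0.

Definition density_matrix (R : realType) (d : nat) (A : 'M[R[i]]_d) : Prop :=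
  psdmx A /\ \tr A = 1.

Definition is_distribution (R : realType) (X : finType) (p : X -> R) : Prop :=
  (forall x, 0 <= p x) /\ \sum_(x : X) p x = 1.

Record ensemble (R : realType) (X : finType) (d : nat) := Ensemble {
  state : X -> 'M[R[i]]_d ;
  prob : X -> R }.

Definition quantum_ensemble (R : realType) (X : finType) (d : nat)
    (Ens : ensemble R X d) : Prop :=
  is_distribution (prob Ens) /\ forall x, density_matrix (state Ens x).

Definition conj_ensemble (R : realType) (X : finType) (d : nat)
    (U : 'M[R[i]]_d) (Ens : ensemble R X d) : ensemble R X d :=
  Ensemble (fun x => U *m state Ens x *m U ^t*) (prob Ens).

Definition povm (R : realType) (d : nat) (Y : finType)
    (E : Y -> 'M[R[i]]_d) : Prop :=
  (forall y, psdmx (E y)) /\ \sum_(y : Y) E y = 1%:M.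

(* The trace of the product of two positive semidefinite matrices is real, so
   taking its real part only changes its type from R[i] to R. *)
Definition joint_law (R : realType) (X : finType) (d : nat)
    (Ens : ensemble R X d) (Y : finType) (E : Y -> 'M[R[i]]_d)
    (x : X) (y : Y) : R :=
  prob Ens x * complex.Re (\tr (E y *m state Ens x)).

(* Guesses are numbered from 0: [sigma y i] is the (i+1)-st guess. *)
Definition guessing_strategy (X Y : finType) (sigma : Y -> 'I_#|X| -> X) : Prop :=
  forall y, bijective (sigma y).

Definition strategy_guesswork (R : realType) (X : finType) (d : nat)
    (Ens : ensemble R X d) (Y : finType) (E : Y -> 'M[R[i]]_d)
    (sigma : Y -> 'I_#|X| -> X) : R :=
  \sum_(y : Y) \sum_(i < #|X|) i.+1%:R * joint_law Ens E (sigma y i) y.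

Definition guesswork_values (R : realType) (X : finType) (d : nat)
    (Ens : ensemble R X d) : set R :=
  [set g : R | exists (Y : finType) (E : Y -> 'M[R[i]]_d)
      (sigma : Y -> 'I_#|X| -> X),
    [/\ povm E, guessing_strategy sigma & g = strategy_guesswork Ens E sigma]].

Definition guesswork (R : realType) (X : finType) (d : nat)
    (Ens : ensemble R X d) : R :=
  inf (guesswork_values Ens).

Lemma psdmx_conj (R : realType) (d : nat) (U A : 'M[R[i]]_d) :
  psdmx A -> psdmx (U *m A *m U ^t*).
Proof.
move=> [/is_hermitianmxP Ah Ap]; split.
  apply/is_hermitianmxP; rewrite expr0 scale1r.
  rewrite expr0 scale1r in Ah.
  by rewrite !trmx_mul !map_mxM /= trmxCK -Ah mulmxA.
move=> v; have := Ap (U ^t* *m v).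
by rewrite trmx_mul map_mxM /= trmxCK !mulmxA.
Qed.

Lemma quantum_ensemble_conj (R : realType) (X : finType) (d : nat)
    (U : 'M[R[i]]_d) (Ens : ensemble R X d) :
  U \is unitarymx -> quantum_ensemble Ens ->
  quantum_ensemble (conj_ensemble U Ens).
Proof.
move=> Uu [Hp Hrho]; split=> // x; have [Hpsd Htr] := Hrho x; split.
  exact: psdmx_conj.
rewrite /= mxtrace_mulC mulmxA -[U ^t*]invmx_unitary //.
by rewrite mulVmx ?unitarymx_unit // mul1mx.
Qed.

Lemma mxtrace_psdmx_mul_ge0 (R : realType) (d : nat) (A B : 'M[R[i]]_d) :
  psdmx A -> psdmx B -> 0 <= \tr (A *m B).
Proof.
move=> Apsd [Bh Bp].
have Bn : B \is normalmx by exact: hermitian_normalmx.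
have Pu := spectral_unitarymx B.
have [+ _] := (orthomx_spectralP Bn, Pu).
set P := spectralmx B; set D := spectral_diag B => BE.
have [_ A'p] := psdmx_conj P Apsd.
have [_ B'p] := psdmx_conj P (conj Bh Bp).
have PtP : P ^t* = invmx P by rewrite invmx_unitary.
have Punit : P \in unitmx by exact: unitarymx_unit.
have diagE (M : 'M[R[i]]_d) j :
    ((delta_mx j 0 : 'cV_d) ^t* *m M *m (delta_mx j 0 : 'cV_d)) 0 0 = M j j.
  by rewrite trmx_delta map_delta_mx -rowE -colE !mxE.
have Dge0 j : 0 <= D 0 j.
  have := B'p (delta_mx j 0).
  rewrite diagE BE PtP !mulmxA mulmxV // mul1mx -mulmxA mulmxV // mulmx1.
  by rewrite mxE eqxx mulr1n.
rewrite BE mulmxA mxtrace_mulC !mulmxA -PtP /mxtrace.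
apply: sumr_ge0 => j _; rewrite mul_mx_diag mxE.
by rewrite mulr_ge0 // -diagE.
Qed.

(* Hence [guesswork] is a genuine infimum. *)
Lemma has_inf_guesswork_values (R : realType) (X : finType) (d : nat)
    (Ens : ensemble R X d) :
  quantum_ensemble Ens -> has_inf (guesswork_values Ens).
Proof.
move=> [[p0 _] Hrho]; split.
  exists (strategy_guesswork Ens (fun _ : unit => 1%:M) (fun=> enum_val)).
  exists unit, (fun _ : unit => 1%:M), (fun=> enum_val); split=> //.
    split; last by rewrite big_const card_unit /= addr0.
    move=> _; split.
      by apply/is_hermitianmxP; rewrite expr0 scale1r trmx1 map_mx1.
    move=> v; rewrite mulmx1 mxE; apply: sumr_ge0 => i _.
    by rewrite !mxE mulrC mul_conjC_ge0.
  by move=> _; exact: enum_val_bij.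
exists 0 => _ [Y [E [sigma [[Epsd _] _ ->]]]].
apply: sumr_ge0 => y _; apply: sumr_ge0 => i _.
rewrite mulr_ge0 // /joint_law mulr_ge0 //.
have [rpsd _] := Hrho (sigma y i).
by have := mxtrace_psdmx_mul_ge0 (Epsd y) rpsd; rewrite lecE => /andP[].
Qed.

(* Main.v *)
Require Import Defs.
From mathcomp Require Import all_boot all_order all_algebra.
From mathcomp Require Import spectral sesquilinear.
From mathcomp Require Import complex.
From mathcomp Require Import boolp classical_sets reals.

(** Conjugating the POVM by the same unitary as the states leaves every joint
    law unchanged, because the trace is cyclic. So each guesswork value of the
    ensemble is also one of the rotated ensemble, and rotating back by the
    adjoint gives the converse: the two infima are over the same set. *)

Import GRing.Theory.
Local Open Scope ring_scope.
Local Open Scope sesquilinear_scope.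
Local Open Scope classical_set_scope.

(** [unitarymx] is defined by the product in the other order; for a square matrix the one-sided
    inverse is two-sided. *)
Lemma mul_adjmx_unitary (R : realType) (d : nat) (U : 'M[R[i]]_d) :
  U \is unitarymx -> U ^t* *m U = 1%:M.
Proof. by move=> Uu; rewrite -invmx_unitary // mulVmx // unitarymx_unit. Qed.

Lemma povm_conj (R : realType) (d : nat) (U : 'M[R[i]]_d) (Y : finType)
    (E : Y -> 'M[R[i]]_d) :
  U \is unitarymx -> povm E -> povm (fun y => U *m E y *m U ^t*).
Proof.
move=> Uu [Epsd E1]; split=> [y|]; first exact: psdmx_conj.
by rewrite -mulmx_suml -mulmx_sumr E1 mulmx1; exact/unitarymxP.
Qed.

Lemma joint_law_conj (R : realType) (X : finType) (d : nat)
    (Ens : ensemble R X d) (U : 'M[R[i]]_d) (Y : finType)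
    (E : Y -> 'M[R[i]]_d) (x : X) (y : Y) :
  U \is unitarymx ->
  joint_law (conj_ensemble U Ens) (fun y => U *m E y *m U ^t*) x y =
  joint_law Ens E x y.
Proof.
move=> Uu; have UV := mul_adjmx_unitary _ _ _ Uu; rewrite /joint_law /=.
(* Cycling the leading [U] to the far right makes it meet the last [U ^t*] and cancel; the inner
   pair is already adjacent. *)
rewrite mxtrace_mulC -!mulmxA mxtrace_mulC -!mulmxA UV mulmx1.
by rewrite (mulmxA (U ^t*)) UV mul1mx mxtrace_mulC.
Qed.

Lemma guesswork_values_sub_conj (R : realType) (X : finType) (d : nat)
    (Ens : ensemble R X d) (U : 'M[R[i]]_d) :
  U \is unitarymx ->
  guesswork_values Ens `<=` guesswork_values (conj_ensemble U Ens).
Proof.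
move=> Uu _ [Y [E [sigma [Epovm sigmab ->]]]].
exists Y, (fun y => U *m E y *m U ^t*), sigma; split=> //.
  exact: povm_conj.
by apply: eq_bigr => y _; apply: eq_bigr => i _; rewrite joint_law_conj.
Qed.

Lemma conj_ensembleK (R : realType) (X : finType) (d : nat)
    (Ens : ensemble R X d) (U : 'M[R[i]]_d) :
  U \is unitarymx -> conj_ensemble (U ^t*) (conj_ensemble U Ens) = Ens.
Proof.
move=> Uu; have UV := mul_adjmx_unitary _ _ _ Uu.
case: Ens => rho p; congr Ensemble; apply/funext => x /=.
by rewrite trmxCK !mulmxA UV mul1mx -mulmxA UV mulmx1.
Qed.

Theorem theorem3 (R : realType) (X : finType) (d : nat)
    (Ens : ensemble R X d) (hEns : quantum_ensemble Ens)
    (U : 'M[R[i]]_d) (hU : U \is unitarymx) :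
  guesswork Ens = guesswork (conj_ensemble U Ens).
Proof.
congr inf; apply/seteqP; split; first exact: guesswork_values_sub_conj.
(* Only the right-hand [Ens] is rewritten, as the rotated ensemble turned back: the goal becomes the
   inclusion already proved, for [conj_ensemble U Ens] and the unitary [U ^t*]. *)
rewrite -{2}(conj_ensembleK _ _ _ Ens _ hU).
by apply: guesswork_values_sub_conj; rewrite trmxC_unitary.
Qed.
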